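(* Let $(X,d)$ be a metric vector space, let $C$ be a nonempty closed and convex subset of $X$, and let $f\colon C\to C$ be a single-valued mapping. Suppose that $f$ satisfies the following conditions: (a) $f\colon C\to C$ is onto; (b) for any finite subset $\{x_1,x_2,\ldots,x_n\}\subseteq C$ and for any convex combination $u=\sum_{i=1}^n\alpha_i x_i$, in which $\alpha_1,\ldots,\alpha_n$ are positive with $\sum_{i=1}^n\alpha_i=1$, we have $$\max\{d(f(x_j),u)-d(x_j,u) : j=1,2,\ldots,n\}\ge 0;$$ (c) there is $x^*\in C$ such that the subset $\{y\in C : d(x^*,y)\le d(f(x^* ),y)\}$ of $C$ is compact. Then $f$ has a fixed point, i.e., there is $x_0\in C$ with $f(x_0)=x_0$.
   Context: A metric vector space $(X,d)$ is a (real) vector space $X$ equipped with a metric $d$ such that $X$ with the topology induced by $d$ is a topological vector space (addition and scalar multiplication are continuous). No continuity of $f$ is assumed. *)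

(* Defs.v *)
From HB Require Import structures.
From mathcomp Require Import all_boot all_order all_algebra.
From mathcomp Require Import all_classical all_reals all_analysis.

Set Implicit Arguments.
Unset Strict Implicit.
Unset Printing Implicit Defensive.

Local Open Scope classical_set_scope.
Local Open Scope ring_scope.

(* The first four fields are those of the factory [isMetric].  A predicate on
   top of [topologicalLmodType] is used because Hierarchy Builder rejects the
   join of [Metric] and [TopologicalLmodule]: [PseudoMetricNormedZmod] was
   declared without an intermediate join of [PseudoMetric] and additive
   structures.  The classes [UniformLmodule] and [Tvs] would be too strong:
   here [d] need not be translation invariant, the operations need not be
   uniformly continuous, and local convexity is not assumed. *)
Record topology_metric (R : realType) (X : topologicalType) (d : X -> X -> R)
    : Prop := TopologyMetric {
  topology_metricxx : forall x, d x x = 0 ;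
  topology_metric_positivity : forall x y, d x y = 0 -> x = y ;
  topology_metric_sym : forall x y, d x y = d y x ;
  topology_metric_triangle : forall y x z, d x z <= d x y + d y z ;
  topology_metric_nbhs :
    forall x : X, nbhs x = nbhs_ball_ (fun a e => [set b | d a b < e]) x
}.

(* Main.v *)
Require Import Defs.
From HB Require Import structures.
From mathcomp Require Import all_boot all_order all_algebra.
From mathcomp Require Import all_classical all_reals all_analysis.
From mathcomp Require Import ring lra.

Set Implicit Arguments.
Unset Strict Implicit.
Unset Printing Implicit Defensive.

Import Order.TTheory GRing.Theory Num.Theory.
Import numFieldNormedType.Exports.

(** For [x] in [C] let [G x] be the set of the [y] in [C] that are at least as
close to [x] as to [f x].  If some [y] lies in all the [G x], then writing
[y = f x], which is possible since [f] is onto, gives [d x y <= d y y = 0], so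
[x = y] and [y] is a fixed point.

Condition (b) says that [G] is a KKM map: a convex combination of
points [x_j] of [C] always belongs to some [G x_j].  The sets [G x] are closed
in [C] because [d x] and [d (f x)] are continuous, and one of them is compact.
Hence it suffices that finitely many of them always meet ([common_point]); the
compactness argument is [all_common_point].

Pulled back to a simplex along [t |-> \sum_j t_j x_j], the finite statement is
the theorem of Knaster, Kuratowski and Mazurkiewicz.  It is derived
([simplex_kkm]) from its dual form [simplex_dual_kkm]: closed sets [A_i] that
cover the simplex, with [A_i] containing the facet [t_i = 0], have a common
point.  The dual form is the limit of a combinatorial statement about labelled
integer grids ([grid_labels]).

The combinatorics does not use a triangulation.  Following Scarf, a set [S] of
grid points is dominant for a set [C] of coordinates if no grid point exceeds
the minimum over [S] in all coordinates of [C].  On a fine grid such an [S] is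
small, since otherwise there would be room for a larger point.  For every
labelling of the grid by coordinates, a parity argument as in Sperner's lemma
finds a dominant pair in which all coordinates of [C] occur as labels on [S]
([scarf]).  The pair is encoded as one set, [S] together with a slack element
for each coordinate outside [C]; the sets with as many elements as there are
coordinates then play the part of simplices, those with one element less the
part of facets. *)

Section Combinatorics.
Import fintype boot.finset.
Local Open Scope nat_scope.
Local Open Scope set_scope.

(** * Dominant sets and their facets *)

Section Dominance.
Variables (I U : finType) (r : I -> U -> nat).
Hypothesis r_inj : forall i, injective (r i).

Definition dominant (B : {set U}) : bool :=
  [forall u, exists i, forall b in B, r i u <= r i b].

Lemma dominantP (B : {set U}) :
  reflect (forall u, exists i, forall b, b \in B -> r i u <= r i b) (dominant B).
Proof.
apply: (iffP forallP) => dB u.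
  by have /existsP[i /forall_inP] := dB u; exists i.
by have [i iB] := dB u; apply/existsP; exists i; apply/forall_inP.
Qed.

Lemma dominant_subset (A B : {set U}) : A \subset B -> dominant B -> dominant A.
Proof.
move=> sAB /dominantP dB; apply/dominantP => u; have [i iB] := dB u.
by exists i => b bA; apply/iB/(subsetP sAB).
Qed.

Lemma argmin_exists (B : {set U}) i : B != set0 ->
  exists2 b, b \in B & forall b', b' \in B -> r i b <= r i b'.
Proof.
by case/set0Pn=> b0 b0B; case: (@arg_minnP _ b0 (mem B) (r i) b0B) => b; exists b.
Qed.

(** When [m k] is the [r k]-least element of a dominant set [B], these are the
elements that can be added to [B] without displacing any minimum but the one
of [l]. *)
Definition beyond (m : I -> U) (l : I) : {set U} :=
  [set t | [forall k, (k != l) ==> (r k (m k) < r k t)]].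

Lemma beyondP m l t :
  reflect (forall k, k != l -> r k (m k) < r k t) (t \in beyond m l).
Proof. by rewrite inE; apply: (iffP forall_inP). Qed.

(** A facet is a dominant set [B] with one element less than there are indices;
[m] lists its minima.  By dominance every element of [B] is a minimum, so
exactly two indices share one.  Any element that is added to [B] must take over
the minimum of one of these two indices, which is why a facet lies in at most
two dominant sets of full size. *)
Section Facet.
Variables (B : {set U}) (m : I -> U).
Hypothesis dB : dominant B.
Hypothesis cardB : #|B|.+1 = #|I|.
Hypothesis mB : forall i, m i \in B.
Hypothesis m_min : forall i b, b \in B -> r i (m i) <= r i b.

Lemma min_surj b : b \in B -> exists i, m i = b.
Proof.
move=> bB; have [i ib] := dominantP _ dB b; exists i.
by apply: (@r_inj i); apply/eqP; rewrite eqn_leq m_min // ib.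
Qed.

Lemma min_repeat : exists i j, i != j /\ m i = m j.
Proof.
have /injectivePn[i [j ij mij]]: ~~ injectiveb m.
  apply/negP=> /injectiveP /card_imset cm.
  have: #|m @: I| <= #|B| by apply/subset_leq_card/subsetP=> _ /imsetP[i _ ->].
  by rewrite cm -cardB ltnn.
by exists i, j.
Qed.

Lemma min_inj l l' : l != l' -> m l = m l' -> {in predC1 l &, injective m}.
Proof.
move=> ll' mll'; apply/imset_injP; apply/eqP.
rewrite cardC1 -cardB.
apply: eq_card => b; apply/imsetP/idP => [[i _ ->//]|/min_surj[i <-]].
case: (eqVneq i l) => [->|il]; last by exists i.
by exists l'; rewrite // inE eq_sym.
Qed.

Section SharedMinimum.
Variables (l l' : I) (ll' : l != l') (mll' : m l = m l').

Lemma beyond_notin t : t \in beyond m l -> t \notin B.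
Proof.
move=> /beyondP Qt; apply/negP=> /min_surj[i it].
suff [k kl kt]: exists2 k, k != l & m k = t.
  by move: (Qt k kl); rewrite kt ltnn.
case: (eqVneq i l) => [il|il]; last by exists i.
by exists l'; [rewrite eq_sym | rewrite -mll' -il].
Qed.

(** Elements of [beyond m l] are bounded through [l] alone, so adding its
[r l]-greatest element keeps the bound; all others are bounded by an [m k] with
[k != l], which remains a minimum. *)
Lemma dominant_add t : t \in beyond m l ->
  (forall u, u \in beyond m l -> r l u <= r l t) -> dominant (t |: B).
Proof.
move=> Qt tmax; apply/dominantP => u.
case: (boolP (u \in beyond m l)) => [Qu|].
  have [k ku] := dominantP _ dB u.
  have kl : k = l.
    by apply/eqP/idPn => kl; have /beyondP/(_ k kl) := Qu; rewrite ltnNge ku.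
  by exists l => b /setU1P[->|bB]; [exact: tmax | rewrite -kl ku].
rewrite inE negb_forall => /existsP[k]; rewrite negb_imply -leqNgt => /andP[kl uk].
exists k => b /setU1P[->|bB]; apply: (leq_trans uk); last exact: m_min.
by apply: ltnW; have /beyondP := Qt; apply.
Qed.

(** Here [t] does not take over the minimum of [l'], so it must take over the one
of [l]: each [m k] with [k != l] still has to be a minimum after the addition,
and [l'] is the only other index that could serve [m l]. *)
Lemma add_dominant t : t \notin B -> dominant (t |: B) -> r l' (m l') <= r l' t ->
  t \in beyond m l /\ (forall u, u \in beyond m l -> r l u <= r l t).
Proof.
move=> tB dtB lt.
have Qt : t \in beyond m l.
  apply/beyondP => k kl; rewrite ltn_neqAle; apply/andP; split.
    by apply: contra tB => /eqP /r_inj <-.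
  have [k' k'B] := dominantP _ dtB (m k).
  have mk : m k' = m k.
    apply: (@r_inj k'); apply/eqP; rewrite eqn_leq m_min // k'B //.
    by rewrite in_setU1 mB orbT.
  have mI := min_inj ll' mll'.
  case: (eqVneq k' l) => [k'l|k'l].
    have -> : k = l' by apply: mI; rewrite ?inE // 1?eq_sym // -mk k'l.
    by [].
  by rewrite (mI k k') ?inE // mk k'B // setU11.
split=> // u /beyondP Qu; have [k kB] := dominantP _ dtB u.
case: (eqVneq k l) => [<-|kl]; first by rewrite kB // setU11.
by have := Qu _ kl; rewrite ltnNge kB // in_setU1 mB orbT.
Qed.
End SharedMinimum.

Definition extremes l : {set U} :=
  [set t in beyond m l | [forall u in beyond m l, r l u <= r l t]].

Lemma card_extremes l : #|extremes l| = (beyond m l != set0).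
Proof.
case: eqVneq => [Q0|/set0Pn[t0 t0Q]].
  by apply/eqP; rewrite cards_eq0 /extremes Q0; apply/eqP/setP=> t; rewrite !in_set.
case: (@arg_maxnP _ t0 (mem (beyond m l)) (r l) t0Q) => t tQ tmax.
suff -> : extremes l = [set t] by rewrite cards1.
apply/setP=> u; rewrite [in LHS]inE in_set1; apply/andP/eqP => [[uQ /forall_inP umax]|->].
  by apply: (@r_inj l); apply/eqP; rewrite eqn_leq (umax t tQ) andbT; apply: tmax.
by split=> //; apply/forall_inP => v /tmax.
Qed.

(** Each of the two indices sharing a minimum contributes at most one element,
the greatest of its [beyond] set; no element serves for both, since it would
exceed all the minima and contradict the dominance of [B]. *)
Lemma card_neighbours i j : i != j -> m i = m j ->
  #|[set t | t \notin B & dominant (t |: B)]| =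
    (beyond m i != set0) + (beyond m j != set0).
Proof.
move=> ij mij; rewrite -!card_extremes.
have -> : [set t | t \notin B & dominant (t |: B)] = extremes i :|: extremes j.
  have ext k k' : k != k' -> m k = m k' -> forall t, t \in extremes k ->
      t \notin B /\ dominant (t |: B).
    move=> kk' mkk' t; rewrite inE => /andP[Qt /forall_inP tmax].
    split; first exact: beyond_notin kk' mkk' _ Qt.
    exact: dominant_add Qt tmax.
  apply/setP=> t; rewrite in_setU inE; apply/andP/orP.
    move=> [tB dtB].
    have [k kB] := dominantP _ dtB (m i).
    have mk : m k = m i.
      apply: (@r_inj k); apply/eqP; rewrite eqn_leq m_min // kB //.
      by rewrite in_setU1 mB orbT.
    have kt : r k (m k) <= r k t by rewrite mk kB // setU11.
    case: (eqVneq k i) => [ki|ki].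
      right; rewrite ki in kt.
      rewrite eq_sym in ij; have [Qt tmax] := add_dominant ij (esym mij) tB dtB kt.
      by rewrite inE Qt; apply/forall_inP.
    have kj : k = j by apply: (min_inj ij mij); rewrite ?inE // 1?eq_sym // mk.
    left; rewrite kj in kt; have [Qt tmax] := add_dominant ij mij tB dtB kt.
    by rewrite inE Qt; apply/forall_inP.
  by case; [apply: ext ij mij _ | apply: ext (esym mij) _; rewrite eq_sym].
rewrite cardsU [_ :&: _](_ : _ = set0) ?cards0 ?subn0 //.
apply/setP=> t; rewrite in_set0; apply/negP.
move=> /setIP[/setIdP[/beyondP Qi _] /setIdP[/beyondP Qj _]].
have [k kt] := dominantP _ dB t.
have : r k (m k) < r k t.
  by case: (eqVneq k i) => [->|]; [apply: Qj | apply: Qi].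
by rewrite ltnNge kt.
Qed.
End Facet.

(** * Parity of the number of full-size dominant sets *)

(** The slack element [e k] is least for [r k] and, for the other orders, above
everything that is not slack: its presence in a set switches the index [k]
off. *)
Section Slack.
Variable e : I -> U.
Hypothesis e_inj : injective e.
Hypothesis e_min : forall i u, r i (e i) <= r i u.
Hypothesis e_top : forall i k u, k != i -> u \notin codom e -> r i u < r i (e k).
Variable u0 : U.
Hypothesis u0P : u0 \notin codom e.

Lemma dominant_slacks i0 : dominant (e @: [set~ i0]).
Proof.
apply/dominantP => u; have [/codomP[k ->]|uN] := boolP (u \in codom e).
  by exists k => b _; apply: e_min.
exists i0 => b /imsetP[k]; rewrite in_setC1 => ki0 ->.
exact/ltnW/e_top.
Qed.

(** A facet lies in two dominant sets of full size, except for the facet made of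
all slack elements but one, which plays the part of the outer face in
Sperner's lemma and lies in one only. *)
Lemma odd_neighbours B i0 : dominant B -> #|B|.+1 = #|I| -> 1 < #|I| ->
    (B \subset codom e -> B = e @: [set~ i0]) ->
  odd #|[set t | t \notin B & dominant (t |: B)]| = (B \subset codom e).
Proof.
move=> dB cB cI Be.
have B0 : B != set0 by rewrite -card_gt0 -ltnS cB.
have /fin_all_exists2[m mB m_min] := fun i => argmin_exists i B0.
have [i [j [ij mij]]] := min_repeat cB mB.
rewrite (card_neighbours dB cB mB m_min ij mij).
have [sB|] := boolP (B \subset codom e); last first.
  case/subsetPn => b bB be.
  (* The slack element of [l] exceeds [b], hence all the other minima. *)
  have Qe l : beyond m l != set0.
    apply/set0Pn; exists (e l); apply/beyondP=> k kl.
    by apply: leq_ltn_trans (m_min k b bB) _; apply: e_top; rewrite // eq_sym.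
  by rewrite !Qe.
have BE := Be sB.
have mE k : k != i0 -> m k = e k.
  move=> ki0; apply: (@r_inj k); apply/eqP; rewrite eqn_leq e_min andbT.
  by apply: m_min; rewrite BE imset_f // in_setC1.
have Q0 : beyond m i0 != set0.
  apply/set0Pn; exists u0; apply/beyondP=> k ki0; rewrite mE //.
  rewrite ltn_neqAle e_min andbT; apply: contra u0P => /eqP/r_inj <-.
  exact: codom_f.
(* An element beyond all minima but the one of [k] exceeds [m i0 = e k] for
   [r i0], so it is slack and differs from [e i0]; but every other slack element
   is itself one of these minima. *)
have Q1 k : k != i0 -> m k = m i0 -> beyond m k = set0.
  move=> ki0 mk; apply/setP=> t; rewrite in_set0; apply/negP => /beyondP Qt.
  have tk : r i0 (e k) < r i0 t by rewrite -mE // mk Qt // eq_sym.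
  have /codomP[l tl] : t \in codom e.
    by apply: contraLR tk => te; rewrite -leqNgt ltnW // e_top.
  rewrite {}tl in Qt tk.
  have li0 : l != i0 by apply: contraTneq tk => ->; rewrite -leqNgt e_min.
  have lk : l != k by apply: contraTneq tk => ->; rewrite ltnn.
  by have := Qt l lk; rewrite mE // ltnn.
case: (eqVneq i i0) => [ii0|ii0].
  by rewrite ii0 Q0 Q1 ?eqxx // -1?ii0 1?eq_sym // mij.
case: (eqVneq j i0) => [ji0|ji0].
  by rewrite ji0 Q0 Q1 ?eqxx // mij ji0.
by move/eqP: ij; case; apply: e_inj; rewrite -!mE.
Qed.

Section Labels.
Variable c : U -> I.
Hypothesis c_slack : forall k, c (e k) = k.

(** As in Sperner's lemma: if [A] has no facet labelled by all indices but [i0],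
the count is zero; otherwise one label occurs twice in [A], and exactly the two
elements carrying it can be removed. *)
Lemma even_facets (A : {set U}) i0 : #|A| = #|I| -> c @: A != setT ->
  ~~ odd #|[set a in A | c @: (A :\ a) == [set~ i0]]|.
Proof.
move=> cA cAT; set F := [set a in A | _].
have [->|/set0Pn[a /setIdP[aA /eqP ca]]] := eqVneq F set0; first by rewrite cards0.
have cai0 : c a != i0.
  apply: contra cAT => /eqP cai; apply/eqP/setP=> i; rewrite in_setT.
  apply/imsetP; have [->|ii0] := eqVneq i i0; first by exists a.
  have : i \in c @: (A :\ a) by rewrite ca in_setC1.
  by case/imsetP=> x /setD1P[_ xA] ->; exists x.
have : c a \in c @: (A :\ a) by rewrite ca in_setC1.
case/imsetP => a' /setD1P[a'a a'A] caa'.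
have cI : {in A :\ a &, injective c}.
  by apply/imset_injP; rewrite ca cardsC1 -cA (cardsD1 a A) aA.
suff -> : F = [set a; a'] by rewrite cards2 eq_sym a'a.
apply/setP=> b; rewrite in_set2; apply/setIdP/orP; last first.
  case=> /eqP->; split=> //; first exact/eqP.
  rewrite -ca; apply/eqP/setP=> i; apply/imsetP/imsetP=> -[x /setD1P[xa xA] ->].
    have [->|xa'] := eqVneq x a; last by exists x => //; apply/setD1P.
    by exists a' => //; apply/setD1P.
  have [->|xa'] := eqVneq x a'; last by exists x => //; apply/setD1P.
  by exists a => //; apply/setD1P; rewrite eq_sym.
move=> [bA /eqP cb]; have [->|ba] := eqVneq b a; [by left | right].
have : c b \in c @: (A :\ b).
  by rewrite cb -ca; apply/imset_f/setD1P.
case/imsetP => x /setD1P[xb xA] cbx; apply/idPn => ba'.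
have [xa|xa] := eqVneq x a.
  case/eqP: ba'; apply: cI; rewrite ?in_setD1 ?ba ?a'a //.
  by rewrite cbx xa caa'.
by case/eqP: xb; apply: cI; rewrite // in_setD1 ?ba ?xa.
Qed.

(** Count the pairs of a facet labelled by all indices but [i0] and a dominant
set of full size containing it.  Summed over the facets the count is odd,
because of the single outer facet [e @: [set~ i0]].  Summed over the full-size
sets it is even as long as none of them carries all the labels. *)
Lemma rainbow_dominant : exists2 A, dominant A & c @: A = setT.
Proof.
have i0 : I := c u0.
(* With a single index the facets are empty and have no minima. *)
have [cI|cI] := leqP #|I| 1.
  have allI i : i = c u0 by move/fintype_le1P: cI; apply.
  case: (@arg_maxnP _ u0 xpredT (r (c u0)) isT) => u _ umax.
  exists [set u].
    by apply/dominantP => v; exists (c u0) => _ /set1P->; apply: umax.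
  by apply/setP=> i; rewrite in_setT (allI i) -(allI (c u)) imset_f ?set11.
have [/exists_inP[A dA /eqP]|noA] := boolP [exists (A | dominant A), c @: A == setT].
  by exists A.
pose facet B := [&& dominant B, #|B|.+1 == #|I| & c @: B == [set~ i0]].
pose full A := dominant A && (#|A| == #|I|).
have double_count : \sum_(B | facet B) \sum_(t | (t \notin B) && dominant (t |: B)) 1 =
  \sum_(A | full A) \sum_(t | (t \in A) && (c @: (A :\ t) == [set~ i0])) 1.
  rewrite (exchange_big_dep xpredT) // [RHS](exchange_big_dep xpredT) //=.
  apply: eq_bigr => t _.
  rewrite [RHS](reindex_onto (fun B => t |: B) (fun A => A :\ t)); last first.
    by move=> A /and3P[_ tA _]; rewrite setD1K.
  apply: eq_bigl => B; rewrite setU11 /full /facet /=.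
  have [tB|tB] := boolP (t \in B).
    rewrite andbF; apply/esym/negP=> /andP[_ /eqP/setP/(_ t)].
    by rewrite tB !inE eqxx.
  rewrite setU1K // eqxx cardsU1 tB add1n andbT /=.
  case dtB : (dominant (t |: B)); rewrite ?andbF //= andbT.
  by rewrite (dominant_subset (subsetUr _ _) dtB).
have : ~~ odd (\sum_(A | full A) \sum_(t | (t \in A) && (c @: (A :\ t) == [set~ i0])) 1).
  apply: (big_ind (fun n => ~~ odd n)) => // [x y|A /andP[dA /eqP cA]].
    by rewrite oddD => /negPf-> /negPf->.
  rewrite sum1dep_card; apply: even_facets => //.
  by apply: contra noA => cAT; apply/exists_inP; exists A.
rewrite -double_count (bigD1 (e @: [set~ i0])) /=; last first.
  rewrite /facet dominant_slacks card_imset // cardsC1 prednK ?eqxx //=; last exact: ltnW.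
  rewrite -imset_comp; apply/eqP/setP=> i.
  apply/imsetP/idP => [[k ki ->]|ii]; first by rewrite /= c_slack.
  by exists i; rewrite /= ?c_slack.
rewrite oddD sum1dep_card.
have slack B : facet B -> B \subset codom e -> B = e @: [set~ i0].
  move=> /and3P[_ /eqP cB /eqP cBi] /subsetP sB; apply/eqP; rewrite eqEcard; apply/andP; split.
    apply/subsetP=> b bB; have /codomP[k bk] := sB b bB.
    by rewrite bk imset_f // -cBi -(c_slack k) imset_f // -bk.
  by rewrite card_imset // cardsC1 -cB.
have cS : #|e @: [set~ i0]|.+1 = #|I|.
  by rewrite card_imset // cardsC1 prednK // ltnW.
rewrite (@odd_neighbours _ i0) ?dominant_slacks //.
have -> : e @: [set~ i0] \subset codom e.
  by apply/subsetP=> _ /imsetP[k _ ->]; apply: codom_f.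
rewrite /= negbK => /negP[]; apply/negP.
apply: (big_ind (fun n => ~~ odd n)) => // [x y|B /andP[dB Bs]].
  by rewrite oddD => /negPf-> /negPf->.
rewrite sum1dep_card (@odd_neighbours _ i0); try by case/and3P: dB => // _ /eqP.
  by apply: contra Bs => /(slack _ dB)->.
exact: slack.
Qed.
End Labels.
End Slack.
End Dominance.

(** * Scarf's lemma and labelled grids *)

(** Scarf's lemma in a weak form that allows ties.  The set found by
[rainbow_dominant] among the points and slack elements consists of [S] and the
slack elements outside [C]. *)
Lemma scarf (I T : finType) (w : I -> T -> nat) (c : T -> I) (t0 : T) :
  exists (S : {set T}) (C : {set I}),
    (forall k, k \in C -> exists2 s, s \in S & c s = k) /\
    (forall t, exists2 i, i \in C & forall s, s \in S -> w i t <= w i s).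
Proof.
(* Ties of [w i] are broken by an enumeration of [T]; the successor leaves the
   value 0 to the slack element. *)
pose v i t := (w i t * #|T| + enum_rank t).+1.
pose M i := \max_t v i t.
pose r i (u : T + I) := match u with
  | inl t => v i t
  | inr k => if k == i then 0 else (M i + enum_rank k).+1
  end.
have vM i t : v i t <= M i by apply: leq_bigmax.
have T0 : 0 < #|T| by rewrite (cardD1 t0).
have v_inj i : injective (v i).
  move=> s t /eqP; rewrite eqSS => /eqP st; apply/enum_rank_inj/val_inj => /=.
  have := congr1 (modn^~ #|T|) st.
  by rewrite !modnMDl !modn_small.
have v_le i s t : v i s <= v i t -> w i s <= w i t.
  rewrite ltnS => /(leq_div2r #|T|).
  by rewrite !divnMDl // !divn_small // !addn0.
have r_inj i : injective (r i).
  case=> [s|k] [t|l] /=.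
  - by move/v_inj->.
  - by case: eqP => // _ E; have := vM i s; rewrite E ltnNge leq_addr.
  - by case: eqP => // _ E; have := vM i t; rewrite -E ltnNge leq_addr.
  case: eqP => [->|_]; case: eqP => [->|_] // [] /addnI E.
  by congr inr; apply/enum_rank_inj/val_inj.
have r_min i u : r i (inr i) <= r i u by rewrite /= eqxx.
have r_top i k u : k != i -> u \notin codom inr -> r i u < r i (inr k).
  move=> /negPf ki; case: u => [t _|l]; last by rewrite codom_f.
  by rewrite /= ki ltnS; apply: leq_trans (vM i t) (leq_addr _ _).
have inlN t : inl t \notin codom (@inr T I) by apply/codomP => -[].
pose lab (u : T + I) := match u with inl t => c t | inr k => k end.
have [A dA cA] := rainbow_dominant r_inj (@inr_inj _ _) r_min r_top (inlN t0)
  (c := lab) (fun=> erefl).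
exists [set t | inl t \in A], [set i | inr i \notin A]; split=> [k|t].
  rewrite inE => kA; have : k \in lab @: A by rewrite cA.
  case/imsetP=> -[t|l] uA /= E; last by rewrite E uA in kA.
  by exists t; rewrite ?inE.
have [i iA] := dominantP _ _ dA (inl t); exists i.
  by rewrite inE; apply/negP => /iA; rewrite /= eqxx.
by move=> s; rewrite inE => /iA /v_le.
Qed.

(** The combinatorial core of the dual theorem: up to [#|I|] grid steps, [s0]
lies on the facet of [i] or carries the label [i], for every [i].  The pair
given by [scarf] is concentrated: if the minima [mu] over [S] left room for a
grid point larger than [mu] in all coordinates of [C], this point would
contradict dominance; so the [mu i] with [i] in [C] add up to almost [m]. *)
Lemma grid_labels (I : finType) (m : nat) (c : {ffun I -> 'I_m.+1} -> I) (i0 : I) :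
  exists2 s0 : {ffun I -> 'I_m.+1}, \sum_i s0 i = m &
    forall i, s0 i <= #|I| \/ exists s : {ffun I -> 'I_m.+1},
      [/\ \sum_i s i = m, c s = i &
          forall k, s k <= s0 k + #|I| /\ s0 k <= s k + #|I|].
Proof.
pose grid (t : {ffun I -> 'I_m.+1}) := \sum_i t i == m.
pose T := {t | grid t}.
pose w i (t : T) : nat := val t i.
have t0P : grid [ffun i => if i == i0 then ord_max else ord0].
  rewrite /grid (bigD1 i0) //= ffunE eqxx big1 ?addn0 // => i /negPf ii0.
  by rewrite ffunE ii0.
pose t0 : T := exist grid _ t0P.
have [S [C [CS dom]]] := scarf w (c \o val) t0.
have [i1 i1C _] := dom t0.
have [s0 s0S _] := CS _ i1C.
have S0 : S != set0 by apply/set0Pn; exists s0.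
have /fin_all_exists2[b bS b_min] := fun i => argmin_exists w i S0.
pose mu i := w i (b i).
have mu_sum : m < \sum_(i in C) (mu i).+1.
  rewrite ltnNge; apply/negP=> le_m.
  pose surplus := m - \sum_(i in C) (mu i).+1.
  (* A grid point above [mu] on [C]; the surplus goes to one coordinate. *)
  pose h i := if i \in C then (mu i).+1 + (if i == i1 then surplus else 0) else 0.
  have sum_h : \sum_i h i = m.
    have surplus_sum : \sum_(i in C) (if i == i1 then surplus else 0) = surplus.
      by rewrite (bigD1 i1) //= eqxx big1 ?addn0 // => i /andP[_ /negPf->].
    by rewrite -big_mkcond /= big_split /= surplus_sum subnKC.
  have h_le i : h i <= m by rewrite -sum_h (bigD1 i) //= leq_addr.
  have tP : grid [ffun i => inord (h i)].
    apply/eqP; rewrite -[RHS]sum_h; apply: eq_bigr => i _.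
    by rewrite ffunE inordK // ltnS.
  have [i iC /(_ _ (bS i))] := dom (exist grid _ tP).
  rewrite /w /= ffunE inordK ?ltnS // /h iC -/(w i (b i)) -/(mu i).
  by rewrite addSn ltnNge leq_addr.
pose nu i := if i \in C then mu i else 0.
have nu_le s i : s \in S -> nu i <= w i s.
  by move=> sS; rewrite /nu; case: ifP => // _; apply: b_min.
have nu_sum : m < \sum_i nu i + #|I|.
  rewrite /nu -big_mkcond /=; apply: leq_trans mu_sum _.
  under eq_bigr do rewrite -addn1.
  by rewrite big_split /= sum1_card leq_add2l max_card.
have near s k : s \in S -> w k s <= nu k + #|I|.
  move=> sS; have /eqP := valP s; rewrite (bigD1 k) //= -/(w k s) => ws.
  rewrite -(leq_add2r (\sum_(i | i != k) val s i)) ws.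
  apply: leq_trans (ltnW nu_sum) _; rewrite (bigD1 k) //= addnAC leq_add2l.
  by apply: leq_sum => i _; apply: nu_le.
exists (val s0); first exact/eqP/(valP s0).
move=> i; have [/CS[s sS cs]|iC] := boolP (i \in C); last first.
  by left; have := near s0 i s0S; rewrite /nu (negPf iC).
right; exists (val s); split=> //; first exact/eqP/(valP s).
by move=> k; split; apply: leq_trans (near _ k _) _; rewrite // leq_add2r nu_le.
Qed.

End Combinatorics.

Local Open Scope classical_set_scope.
Local Open Scope ring_scope.

(** * The Knaster-Kuratowski-Mazurkiewicz theorem on a simplex *)

Definition simplex (R : realType) (n : nat) : set 'rV[R]_n :=
  [set x | (forall i, 0 <= x ord0 i) /\ \sum_i x ord0 i = 1].

Lemma closed_simplex (R : realType) n : closed (@simplex R n).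
Proof.
have -> : @simplex R n =
    (\bigcap_(i in [set: 'I_n]) ((fun x : 'rV[R]_n => x ord0 i) @^-1` [set y | 0 <= y])) `&`
    ((fun x : 'rV[R]_n => \sum_i x ord0 i) @^-1` [set 1]).
  by apply/seteqP; split=> [x [x0 x1]|x [x0 x1]]; split=> // i; [move=> _|]; apply: x0.
apply: closedI.
  apply: closed_bigI => i _; apply: preimage_closed; last exact: closed_ge.
  by move=> x _; apply: coord_continuous.
apply: preimage_closed; last exact: closed_eq.
by move=> x _; apply: (continuous_big (@add_continuous R^o)) => i _; apply: coord_continuous.
Qed.

Lemma simplex_compact (R : realType) n : compact (@simplex R n).
Proof.
have cube := @rV_compact R n (fun=> `[0, 1]%classic) (fun=> @segment_compact R 0 1).
apply: subclosed_compact cube _; first exact: closed_simplex.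
move=> x [x0 x1] i /=; rewrite in_itv /= x0 -x1 (bigD1 i) //= lerDl.
exact: sumr_ge0.
Qed.

Lemma nbhs_rV (R : realType) n (p : 'rV[R]_n) (B : set 'rV[R]_n) :
  nbhs p B <->
  exists2 e, 0 < e & forall y : 'rV[R]_n, (forall i, `|p ord0 i - y ord0 i| < e) -> B y.
Proof.
split=> [/nbhs_ballP[e /= e0 eB]|[e e0 eB]].
  exists e => // y py; apply: eB; split=> // i j; rewrite (ord1 i).
  exact: py.
apply/nbhs_ballP; exists e => //= y [_ py]; apply: eB => i; exact: py.
Qed.

(** The approximate form of the dual theorem, from a grid so fine that [n.+1]
steps are shorter than [e].  A grid point is labelled by a set [A i] to
which it belongs. *)
Lemma simplex_approx (R : realType) n (A : 'I_n.+1 -> set 'rV[R]_n.+1) (e : R) :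
  (forall x, simplex x -> exists i, A i x) -> 0 < e ->
  exists2 x, simplex x & forall i, x ord0 i < e \/
    exists2 y, A i y & forall k, `|y ord0 k - x ord0 k| < e.
Proof.
move=> cover e0.
pose m := (Num.Def.truncn (n.+1%:R / e)).+1.
have m0 : 0 < m%:R :> R by rewrite ltr0n.
have me : n.+1%:R / m%:R < e.
  by rewrite ltr_pdivrMr // mulrC -ltr_pdivrMr // truncnS_gt.
pose emb (t : {ffun 'I_n.+1 -> 'I_m.+1}) : 'rV[R]_n.+1 := \row_i ((t i)%:R / m%:R).
have embP (t : {ffun 'I_n.+1 -> 'I_m.+1}) : (\sum_i t i)%N = m -> simplex (emb t).
  move=> st; split=> [i|]; first by rewrite mxE divr_ge0.
  under eq_bigr do rewrite mxE.
  by rewrite -mulr_suml -natr_sum st divff // gt_eqF.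
have /choice[c cP] : forall t : {ffun 'I_n.+1 -> 'I_m.+1}, exists i,
    (\sum_i t i)%N = m -> A i (emb t).
  move=> t; have [/embP/cover[i Ai]|] := pselect ((\sum_i t i)%N = m); first by exists i.
  by exists ord0.
have [s0 s0m s0P] := grid_labels c ord0.
have div_lt (a b : nat) : (a <= b + n.+1)%N -> a%:R / m%:R < b%:R / m%:R + e.
  move=> ab; apply: le_lt_trans (_ : (b + n.+1)%:R / m%:R < _).
    by rewrite ler_pM2r ?invr_gt0 // ler_nat.
  by rewrite natrD mulrDl ltrD2l.
exists (emb s0); first exact: embP.
move=> i; have := s0P i; rewrite card_ord => -[s0i|[s [/cP As cs ss0]]].
  by left; rewrite mxE; have := div_lt (s0 i) 0; rewrite mul0r add0r; apply.
right; exists (emb s); first by rewrite -cs.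
move=> k; have [/div_lt sk /div_lt s0k] := ss0 k.
by rewrite !mxE ltr_distlC; apply/andP; split; lra.
Qed.

(** A cluster point [p], as [e] tends to 0, of the points given by
[simplex_approx].  If [p] were outside the closed set [A i], its coordinate [i]
would be positive by the facet condition, so near [p] both alternatives of
[simplex_approx] fail for small [e]. *)
Lemma simplex_dual_kkm (R : realType) n (A : 'I_n.+1 -> set 'rV[R]_n.+1) :
  (forall i, closed (A i)) -> (forall x, simplex x -> exists i, A i x) ->
  (forall i x, simplex x -> x ord0 i = 0 -> A i x) ->
  exists2 x, simplex x & forall i, A i x.
Proof.
move=> A_closed cover facet.
pose W (e : R) := [set x : 'rV[R]_n.+1 | simplex x /\ forall i, x ord0 i < e \/
    exists2 y, A i y & forall k, `|y ord0 k - x ord0 k| < e].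
have W_mono e e' : e <= e' -> W e `<=` W e'.
  move=> ee' x [xS xW]; split=> // i; case: (xW i) => [xe|[y Ay xy]].
    by left; apply: lt_le_trans ee'.
  by right; exists y => // k; apply: lt_le_trans ee'.
have W_filter : ProperFilter (filter_from [set e : R | 0 < e] W).
  apply: filter_from_proper => [|e e0]; last first.
    by have [x xS xW] := simplex_approx cover e0; exists x.
  apply: filter_from_filter; first by exists 1 => /=.
  move=> e e' e0 e'0; exists (Num.min e e'); first by rewrite /= lt_min e0.
  by move=> x xW; split; apply: W_mono xW; rewrite ge_min lexx ?orbT.
have [p [pS p_cluster]] := @simplex_compact R n.+1 _ W_filter
  (ex_intro2 _ _ 1 ltr01 (fun x => @proj1 _ _)).
exists p => // i; apply: contrapT => Ap.
have p0 : 0 < p ord0 i.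
  rewrite lt_neqAle (pS.1 i) andbT eq_sym; apply/negP => /eqP /(facet _ _ pS).
  exact: Ap.
have [e e0 eA] : exists2 e, 0 < e & forall y : 'rV[R]_n.+1,
    (forall k, `|p ord0 k - y ord0 k| < e) -> ~ A i y.
  by apply/nbhs_rV; apply: open_nbhs_nbhs; split=> //; apply: closed_openC.
(* Room for two steps: from [p] to a nearby point [x] of [W e'], then from [x] to
   a point of [A i] or to a zero of the coordinate [i]. *)
pose e' := Num.min (e / 2) (p ord0 i / 2).
have e'0 : 0 < e' by rewrite lt_min !divr_gt0.
have [e'e e'p] : e' <= e / 2 /\ e' <= p ord0 i / 2.
  by rewrite !ge_min !lexx orbT.
have [x [[_ xW] xp]] : (W e' `&`
    [set x : 'rV[R]_n.+1 | forall k, `|p ord0 k - x ord0 k| < e']) !=set0.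
  by apply: p_cluster; [exists e' | apply/nbhs_rV; exists e'].
case: (xW i) => [xi|[y Ay xy]].
  by have := xp i; rewrite ltr_distl; lra.
apply: (eA y) => // k; have := xp k; have := xy k.
by rewrite !ltr_distl; lra.
Qed.

(** The dual theorem applies to the sets where [g i] is at least the share [x_i]
of the total [G]: they cover the simplex because the shares add up to [G].  At
a common point all these inequalities are equalities, as their sums agree; some
[i] has [x_i > 0] and [g i x = 0], which forces [G x = 0]. *)
Lemma simplex_kkm (R : realType) n (g : 'I_n.+1 -> 'rV[R]_n.+1 -> R) :
  (forall i, continuous (g i)) -> (forall i x, 0 <= g i x) ->
  (forall x, simplex x -> exists2 i, 0 < x ord0 i & g i x = 0) ->
  exists2 x, simplex x & forall i, g i x = 0.
Proof.
move=> g_cont g_ge0 g_face.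
pose G x := \sum_i g i x.
have G_cont : continuous G.
  by apply: (continuous_big (@add_continuous R^o)) => i _; apply: g_cont.
have [|x xS|i x xS xi|x xS xA] :=
    @simplex_dual_kkm R n (fun i => [set x : 'rV[R]_n.+1 | x ord0 i * G x <= g i x]).
- move=> i; rewrite [X in closed X](_ : _ =
      (fun x : 'rV[R]_n.+1 => g i x - x ord0 i * G x) @^-1` [set y | 0 <= y]); last first.
    by apply/seteqP; split=> x /=; rewrite subr_ge0.
  apply: preimage_closed; last exact: closed_ge.
  move=> x _.
  suff: {for x, continuous (fun x : 'rV[R]_n.+1 => g i x - x ord0 i * G x)} by [].
  apply: continuousB; first exact: g_cont.
  by apply: continuousM; [apply: coord_continuous | apply: G_cont].
- apply: contrapT => /forallNP xA.
  have: \sum_i g i x < \sum_i x ord0 i * G x.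
    apply: ltr_sum => [|i _]; first by apply/hasP; exists ord0; rewrite // mem_index_enum.
    by rewrite ltNge; apply/negP/xA.
  by rewrite -mulr_suml xS.2 mul1r ltxx.
- by rewrite /= xi mul0r.
have xE i : g i x = x ord0 i * G x.
  apply/eqP; rewrite eq_le xA andbT leNgt; apply/negP => gi.
  have: \sum_j x ord0 j * G x < \sum_j g j x.
    rewrite (bigD1 i) //= [ltRHS](bigD1 i) //=; apply: ltr_leD => //.
    by apply: ler_sum => j _; apply: xA.
  by rewrite -mulr_suml xS.2 mul1r ltxx.
exists x => // i; have [j xj gj] := g_face x xS.
have /eqP : x ord0 j * G x = 0 by rewrite -xE.
by rewrite mulf_eq0 gt_eqF //= => /eqP G0; rewrite xE G0 mulr0.
Qed.

(** * Metric and linear preliminaries *)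

Lemma dist_ge0 (R : realType) (X : topologicalType) (d : X -> X -> R) :
  topology_metric d -> forall x y, 0 <= d x y.
Proof.
case=> dxx _ dC dtri _ x y; have := dtri y x x.
by rewrite dxx (dC y x); lra.
Qed.

Lemma dist_continuous (R : realType) (X : topologicalType) (d : X -> X -> R) :
  topology_metric d -> forall x, continuous (d x).
Proof.
move=> dm x y; apply/cvgrPdist_lt => e e0.
have : nbhs y [set z | d y z < e] by rewrite (topology_metric_nbhs dm); exists e.
apply: filterS => z yz; rewrite /= ltr_distl.
have := topology_metric_triangle dm y x z.
have := topology_metric_triangle dm z x y; rewrite (topology_metric_sym dm z y).
by move: yz => /= ? ? ?; apply/andP; split; lra.
Qed.

(** By induction on the list of indices, for normalized partial sums: the
hypothesis on [C] only concerns two points. *)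
Lemma convex_set_sum (R : realType) (X : lmodType R) (C : set X) :
  convex_set C -> forall n (x : 'I_n -> X) (t : 'rV[R]_n),
  (forall i, C (x i)) -> simplex t -> C (\sum_i t ord0 i *: x i).
Proof.
move=> C_convex n x t xC [t0 t1].
have scaled (r : seq 'I_n) : 0 < \sum_(i <- r) t ord0 i ->
    C ((\sum_(i <- r) t ord0 i)^-1 *: \sum_(i <- r) t ord0 i *: x i).
  elim: r => [|i r IHr]; first by rewrite big_nil ltxx.
  rewrite !big_cons; set s := \sum_(_ <- r) _ in IHr *.
  have [s0|s_neq0] := eqVneq s 0.
    have -> : \sum_(j <- r) t ord0 j *: x j = 0.
      rewrite big1_seq // => j /andP[_ jr]; have /eqP := s0.
      by rewrite psumr_eq0 // => /allP/(_ j jr)/eqP->; rewrite scale0r.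
    by rewrite s0 !addr0 => ti; rewrite scalerA mulVf ?scale1r // gt_eqF.
  have s_gt0 : 0 < s by rewrite lt_neqAle eq_sym s_neq0 sumr_ge0.
  have [->|ti_neq0] := eqVneq (t ord0 i) 0.
    by rewrite scale0r !add0r.
  have ti_gt0 : 0 < t ord0 i by rewrite lt_neqAle eq_sym ti_neq0 t0.
  move=> S_gt0.
  have w0 : 0 <= t ord0 i / (t ord0 i + s) by rewrite divr_ge0 ?ltW.
  have w1 : t ord0 i / (t ord0 i + s) <= 1 by rewrite ler_pdivrMr // mul1r lerDl ltW.
  have convE (p : {i01 R}) (a b : X) :
      conv p (a : convex_lmodType X) b = p%:num *: a + (1 - p%:num) *: b by [].
  have := C_convex (x i) _ (Itv01 w0 w1) (mem_set (xC i)) (mem_set (IHr s_gt0)).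
  move/set_mem; rewrite convE; congr C.
  rewrite /= scalerDr !scalerA; congr (_ *: _ + _ *: _); first exact: mulrC.
  by field; rewrite !gt_eqF.
by have := scaled (index_enum _); rewrite t1 invr1 scale1r; apply.
Qed.

Lemma combination_continuous (R : realType) (X : topologicalLmodType R) n
    (x : 'I_n -> X) :
  continuous (fun t : 'rV[R]_n => \sum_i t ord0 i *: x i).
Proof.
apply: (continuous_big (@add_continuous X)) => i _ t.
apply: (@continuous2_cvg _ _ _ _ _ _ (fun t : 'rV[R]_n => t ord0 i : R^o) (fun=> x i)
  (fun (a : R^o) (v : X) => a *: v)).
- exact: (nbhs_filter t).
- exact: (@scale_continuous R X (t ord0 i, x i)).
- exact: coord_continuous.
- exact: (@cst_continuous _ _ (x i) t).
Qed.

(** * KKM families in a convex set *)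

(** [simplex_kkm] for the positive parts of the [h i], pulled back along the
parametrization of the convex hull of the [x j]. *)
Lemma kkm_points (R : realType) (X : topologicalLmodType R) n (x : 'I_n.+1 -> X)
    (h : 'I_n.+1 -> X -> R) :
  (forall i, continuous (h i)) ->
  (forall t : 'rV[R]_n.+1, simplex t ->
    exists2 i, 0 < t ord0 i & h i (\sum_j t ord0 j *: x j) <= 0) ->
  exists2 t : 'rV[R]_n.+1, simplex t & forall i, h i (\sum_j t ord0 j *: x j) <= 0.
Proof.
move=> h_cont h_face.
pose g i (t : 'rV[R]_n.+1) := Num.max 0 (h i (\sum_j t ord0 j *: x j)).
have [i|i t|t tS|t tS gt] := @simplex_kkm R n g.
- move=> t; apply: (@continuous_max _ _ (fun=> 0)); first exact: cst_continuous.
  apply: (@continuous_comp _ _ _ (fun t : 'rV[R]_n.+1 => \sum_j t ord0 j *: x j)).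
    exact: combination_continuous.
  exact: h_cont.
- by rewrite le_max lexx.
- by have [i ti hi] := h_face t tS; exists i => //; apply/max_idPl.
by exists t => // i; apply/max_idPl/gt.
Qed.

(** Fan's version of the theorem for the sets [[set y | h x y <= 0]]; [h_hull]
says that they form a KKM family on [C]. *)
Section KKM.
Variables (R : realType) (X : topologicalLmodType R).
Variables (C : set X) (h : X -> X -> R).
Hypothesis C_convex : convex_set C.
Hypothesis h_continuous : forall x, continuous (h x).
Hypothesis h_hull : forall (n : nat) (x : 'I_n.+1 -> X) (alpha : 'I_n.+1 -> R),
  injective x -> (forall i, C (x i)) ->
  (forall i, 0 < alpha i) -> \sum_i alpha i = 1 ->
  exists j, h (x j) (\sum_i alpha i *: x i) <= 0.

(** [h_hull] requires positive coefficients, so it is applied to the points with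
a positive barycentric coordinate only.  This is what yields an index [i] in
the support of [t]. *)
Lemma hull_support n (x : 'I_n -> X) (t : 'rV[R]_n) :
  injective x -> (forall i, C (x i)) -> simplex t ->
  exists2 i, 0 < t ord0 i & h (x i) (\sum_j t ord0 j *: x j) <= 0.
Proof.
move=> x_inj xC [t0 t1].
pose r := [seq i <- index_enum 'I_n | 0 < t ord0 i].
have sum_r (V : nmodType) (F : 'I_n -> V) :
    (forall i, t ord0 i = 0 -> F i = 0) -> \sum_(i <- r) F i = \sum_i F i.
  move=> F0; rewrite big_filter big_mkcond; apply: eq_bigr => i _.
  by case: ltP => // ti; rewrite F0 //; apply/eqP; rewrite eq_le ti t0.
have r_uniq : uniq r by rewrite filter_uniq // index_enum_uniq.
have r_pos i : i \in r -> 0 < t ord0 i by rewrite mem_filter => /andP[].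
have sum_t : \sum_(i <- r) t ord0 i = 1 by rewrite sum_r.
have sum_x : \sum_(i <- r) t ord0 i *: x i = \sum_i t ord0 i *: x i.
  by apply: sum_r => i ->; rewrite scale0r.
rewrite -{}sum_x.
case: r sum_t r_uniq r_pos {sum_r} => [|i0 r].
  by rewrite big_nil => /esym/eqP; rewrite oner_eq0.
set s := i0 :: r => sum_t s_uniq s_pos.
have sP (j : 'I_(size r).+1) : nth i0 s j \in s by rewrite mem_nth.
have [|||j hj] := @h_hull _ (fun j : 'I_(size r).+1 => x (nth i0 s j))
    (fun j => t ord0 (nth i0 s j)) _ (fun j => xC _).
- by move=> j k /x_inj /eqP; rewrite nth_uniq // => /eqP; exact: val_inj.
- by move=> j; apply: s_pos.
- by rewrite -[RHS]sum_t (big_nth i0) big_mkord.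
exists (nth i0 s j); first exact: s_pos.
by rewrite (big_nth i0) big_mkord.
Qed.

Lemma common_point (a : X) (s : seq X) : (forall x, x \in a :: s -> C x) ->
  exists2 y, C y & forall x, x \in a :: s -> h x y <= 0.
Proof.
move=> sC.
have : size (undup (a :: s)) != 0%N.
  by rewrite -lt0n -has_predT; apply/hasP; exists a; rewrite // mem_undup mem_head.
case E : (size _) => [//|n] _.
pose x (i : 'I_n.+1) := nth a (undup (a :: s)) i.
have xP i : x i \in a :: s by rewrite -mem_undup mem_nth // E.
have x_inj : injective x.
  by move=> i j /eqP; rewrite nth_uniq ?E ?undup_uniq // => /eqP; exact: val_inj.
have xC i : C (x i) by apply: sC.
have [i|t|t tS tP] := @kkm_points R X n x (h \o x).
- exact: h_continuous.
- exact: hull_support.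
exists (\sum_j t ord0 j *: x j); first exact: convex_set_sum.
move=> b; rewrite -mem_undup => bs.
have bi : (index b (undup (a :: s)) < n.+1)%N by rewrite -E index_mem.
by have := tP (Ordinal bi); rewrite /x /= nth_index.
Qed.

(** The finite intersections inside the compact set of [a] generate a proper
filter; a cluster point lies in every set of the family, as these are closed.
*)
Lemma all_common_point a : C a -> compact [set y | C y /\ h a y <= 0] ->
  exists2 y, C y & forall x, C x -> h x y <= 0.
Proof.
move=> aC; set K := [set y | _]; move=> K_compact.
pose W (s : seq X) := [set y | K y /\ forall x, x \in s -> h x y <= 0].
pose D := [set s : seq X | forall x, x \in s -> C x].
have W_filter : ProperFilter (filter_from D W).
  apply: filter_from_proper => [|s sD].
    apply: filter_from_filter; first by exists [::].
    move=> s s' sD s'D; exists (s ++ s').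
      by move=> x; rewrite mem_cat => /orP[/sD|/s'D].
    by move=> y [Ky yP]; split; split=> // x xs; apply: yP; rewrite mem_cat xs ?orbT.
  have [|y Cy yP] := @common_point a s.
    by move=> x; rewrite in_cons => /orP[/eqP->|/sD].
  exists y; split; first by split=> //; apply: yP; rewrite mem_head.
  by move=> x xs; apply: yP; rewrite in_cons xs orbT.
have [|y [[Cy _] y_cluster]] := K_compact _ W_filter.
  by exists [::] => // y [].
exists y => // x Cx.
have : closed [set z | h x z <= 0].
  apply: (@preimage_closed _ _ (h x) [set r | r <= 0]); last exact: closed_le.
  by move=> z _; apply: h_continuous.
apply=> B By; apply: y_cluster By; exists [:: x].
  by move=> z; rewrite mem_seq1 => /eqP->.
by move=> z [_ zP]; apply: zP; rewrite mem_seq1.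
Qed.
End KKM.

(** * The fixed point *)

Lemma bigmax_ge0 (R : realDomainType) (n : nat) (F : 'I_n.+1 -> R) :
  0 <= \big[Num.max/F ord0]_j F j -> exists j, 0 <= F j.
Proof.
move=> F0; apply: contrapT => /forallNP Fn.
have Flt j : F j < 0 by rewrite ltNge; apply/negP/Fn.
by move: F0; rewrite leNgt bigmax_lt.
Qed.

Theorem theorem1 (R : realType) (X : topologicalLmodType R) (d : X -> X -> R)
    (d_metric : topology_metric d)
    (C : set X) (f : X -> X)
    (C_nonempty : C !=set0) (C_closed : closed C) (C_convex : convex_set C)
    (f_CC : set_fun C C f)
    (f_onto : set_surj C C f)
    (f_hull : forall (n : nat) (x : 'I_n.+1 -> X) (alpha : 'I_n.+1 -> R)
        (u : X),
      injective x -> (forall i, C (x i)) ->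
      (forall i, 0 < alpha i) -> \sum_i alpha i = 1 ->
      u = \sum_i alpha i *: x i ->
      0 <= \big[Num.max/(d (f (x ord0)) u - d (x ord0) u)]_j
             (d (f (x j)) u - d (x j) u))
    (f_compact : exists2 xs : X, C xs &
      compact [set y : X | C y /\ d xs y <= d (f xs) y]) :
  exists2 x0 : X, C x0 & f x0 = x0.
Proof.
have [a aC K_compact] := f_compact.
have [x|n x alpha x_inj xC alpha_gt0 alpha1||y Cy yP] :=
    @all_common_point R X C (fun x y => d x y - d (f x) y) C_convex _ _ a aC.
- by move=> y; apply: (@continuousB _ R^o); apply: dist_continuous.
- have [j dj] := bigmax_ge0 (f_hull n x alpha _ x_inj xC alpha_gt0 alpha1 erefl).
  by exists j; rewrite subr_le0 -subr_ge0.
- by under eq_set do rewrite subr_le0.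
have [x Cx fx] := f_onto y Cy.
suff xy : x = y by exists y; rewrite // -{1}xy.
apply: (topology_metric_positivity d_metric).
apply/eqP; rewrite eq_le dist_ge0 // andbT.
by have := yP x Cx; rewrite fx (topology_metricxx d_metric) subr0.
Qed.
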